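(* Let $\gamma$ be the unique $C^\infty$ solution, on some interval $[0,s_*]$ with $s_*>0$, of the singular initial value problem $$(1-2ns)\gamma'(s)-H(\gamma(s))+4\,\frac{s\gamma'(s)+s^2\gamma''(s)}{1+4s^2\gamma'(s)^2}=0,\qquad \gamma(0)=0.$$ Then there exist a rescaling parameter $\lambda\in(0,1]$, a small $s_0>0$ with $\lambda s_0\le s_*$, and a large $M$ (depending on $H$) such that the rescaled solution $\tilde\gamma(s)=\gamma(\lambda s)$ satisfies, for all integers $j\ge2$ and all $s\in[0,s_0]$, $$\|\tilde\gamma^{(j)}\|_{L^2[0,s]}+\left|\left(\tfrac{d}{ds}\right)^{j-1}\big(s\tilde\gamma'(s)\big)\right|\le M^{j-3}\,\frac{((j-2)!)^2}{j-1}.$$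
   Context: Let $n\ge2$ and let $\Gamma\subset S^n$ be a compact connected embedded isoparametric hypersurface (constant principal curvatures), strictly mean convex with respect to the inner orientation. $H(d)$ denotes the (constant) mean curvature (sum of principal curvatures) of the parallel hypersurface $\Gamma_d$ at distance $d$ on the outer side of $\Gamma$, i.e. $H(d)=\Delta_{S^n}d$ on $\Gamma_d$ where $d$ is the distance to $\Gamma$; the outer side is the one with $H(0)>0$. There is $d_0>0$ with $H>0$, $H'<0$ on $[0,d_0)$ and $H(d_0)=0$; $H$ is real analytic near $[0,d_0]$. Solutions $\gamma$ take values in $[0,d_0)$. The rescaled function satisfies $4\frac{s^2\tilde\gamma''+s\tilde\gamma'}{1+4s^2\tilde\gamma'^2}+(\frac1\lambda-2ns)\tilde\gamma'-H(\tilde\gamma)=0$, $\tilde\gamma(0)=0$. *)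

(* Defs.v *)
From HB Require Import structures.
From mathcomp Require Import all_boot all_order all_algebra.
From mathcomp Require Import all_classical all_reals all_analysis.

Set Implicit Arguments.
Unset Strict Implicit.
Unset Printing Implicit Defensive.

Import Order.TTheory GRing.Theory Num.Theory.
Import numFieldNormedType.Exports.

Local Open Scope classical_set_scope.
Local Open Scope ring_scope.

(** * Isoparametric hypersurfaces of the round sphere *)

(* The library norm on 'rV[R]_m is the sup norm; the Euclidean structure of
   R^m, hence the round metric of S^n, comes from [dot]. *)
Definition dot {R : realType} {m : nat} (u v : 'rV[R]_m) : R :=
  \sum_(i < m) u 0 i * v 0 i.

Definition unit_sphere {R : realType} {n : nat} : set 'rV[R]_n.+1 :=
  [set x | dot x x = 1].

Definition iter_derive {R : realType} {V W : normedModType R}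
    (f : V -> W) (vs : seq V) : V -> W :=
  foldr (fun v g => fun x => 'D_v g x) f vs.

(* C^infinity on U, for U open and V finite dimensional: all iterated
   directional derivatives exist and are continuous on U. *)
Definition smooth_in {R : realType} {V W : normedModType R}
    (U : set V) (f : V -> W) : Prop :=
  forall (vs : seq V) (x : V), U x ->
    {for x, continuous (iter_derive f vs)} /\
    forall v, derivable (iter_derive f vs) x v.

(* Near each of its points G is, inside S^n, the zero set of a smooth function
   phi whose gradient along S^n does not vanish on G; [nu] is a smooth field of
   unit vectors, tangent to S^n and parallel to that gradient. Only the values
   of [nu] on G and its derivatives in directions tangent to G are ever used. *)
Definition embedded_hypersurface {R : realType} {n : nat}
    (G : set 'rV[R]_n.+1) (nu : 'rV[R]_n.+1 -> 'rV[R]_n.+1) : Prop :=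
  [/\ G `<=` unit_sphere,
      (exists U, [/\ open U, G `<=` U & smooth_in U nu]),
      (forall p, G p -> dot (nu p) (nu p) = 1 /\ dot (nu p) p = 0) &
      (forall p, G p ->
        exists (U : set 'rV[R]_n.+1) (phi : 'rV[R]_n.+1 -> R),
          [/\ open U, U p, smooth_in U phi,
              G `&` U = unit_sphere `&` U `&` [set x | phi x = 0] &
              forall x, (G `&` U) x -> exists2 c : R, c != 0 &
                forall v, dot x v = 0 -> 'D_v phi x = c * dot (nu x) v])].

(* The shape operator of G at p is, up to the sign given by the choice of [nu],
   v |-> 'D_v nu p on T_p G = {p, nu p}^perp: this vector is already orthogonal
   to p since dot (nu x) x = 0 on G. *)
Definition constant_principal_curvatures {R : realType} {n : nat}
    (G : set 'rV[R]_n.+1) (nu : 'rV[R]_n.+1 -> 'rV[R]_n.+1) : Prop :=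
  exists kappa : 'I_n.-1 -> R, forall p, G p ->
    exists e : 'I_n.-1 -> 'rV[R]_n.+1,
      [/\ forall i, dot (e i) p = 0 /\ dot (e i) (nu p) = 0,
          forall i j, dot (e i) (e j) = (i == j)%:R &
          forall i, 'D_(e i) nu p = kappa i *: e i].

Definition isoparametric_hypersurface {R : realType} {n : nat}
    (G : set 'rV[R]_n.+1) : Prop :=
  [/\ G !=set0, compact G, connected G &
      exists2 nu, embedded_hypersurface G nu &
                  constant_principal_curvatures G nu].

Definition is_side {R : realType} {n : nat} (G Om : set 'rV[R]_n.+1) : Prop :=
  exists2 x, (unit_sphere `\` G) x & Om = connected_component (unit_sphere `\` G) x.

(* Geodesic distance in S^n. *)
Definition sphere_dist {R : realType} {n : nat} (G : set 'rV[R]_n.+1)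
    (x : 'rV[R]_n.+1) : R :=
  inf [set acos (dot x p) | p in G].

(* The distance to G, taken negative off the side [Om], so that it is smooth
   across G. *)
Definition signed_dist {R : realType} {n : nat} (G Om : set 'rV[R]_n.+1)
    (x : 'rV[R]_n.+1) : R :=
  if x \in Om then sphere_dist G x else - sphere_dist G x.

(* Laplace-Beltrami operator of S^n: the Laplacian of R^(n+1) applied to the
   extension of u that is homogeneous of degree 0. *)
Definition sphere_laplacian {R : realType} {n : nat} (u : 'rV[R]_n.+1 -> R)
    (x : 'rV[R]_n.+1) : R :=
  let ext := fun y : 'rV[R]_n.+1 => u ((Num.sqrt (dot y y))^-1 *: y) in
  \sum_(i < n.+1) 'D_(delta_mx 0 i) (fun y => 'D_(delta_mx 0 i) ext y) x.

Definition parallel_hypersurface {R : realType} {n : nat}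
    (G Om : set 'rV[R]_n.+1) (d : R) : set 'rV[R]_n.+1 :=
  [set x | unit_sphere x /\ signed_dist G Om x = d].

(* For d in [0, d0], H d is the mean curvature of the parallel hypersurface at
   distance d on the side [Om]. *)
Definition mean_curvature_of_parallels {R : realType} {n : nat}
    (G Om : set 'rV[R]_n.+1) (d0 : R) (H : R -> R) : Prop :=
  forall d, 0 <= d <= d0 -> forall x, parallel_hypersurface G Om d x ->
    sphere_laplacian (signed_dist G Om) x = H d.

(** * Functions of one variable *)

Definition real_analytic_at {R : realType} (f : R -> R) (x : R) : Prop :=
  exists a : R^nat, \forall y \near x, pseries a (y - x) @ \oo --> f y.

(* Derivatives relative to A: at an end point of an interval A they are
   one-sided, and only the values of f on A matter. *)
Definition derivable_on {R : realType} (A : set R) (f : R -> R) (x : R) : Prop :=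
  cvg ((f y - f x) / (y - x) @[y --> within (A `\ x) (nbhs x)]).

Definition derive_on {R : realType} (A : set R) (f : R -> R) (x : R) : R :=
  lim ((f y - f x) / (y - x) @[y --> within (A `\ x) (nbhs x)]).

Definition derive_n_on {R : realType} (A : set R) (k : nat) (f : R -> R)
    : R -> R :=
  iter k (derive_on A) f.

Definition smooth_on {R : realType} (A : set R) (f : R -> R) : Prop :=
  forall k x, A x -> derivable_on A (derive_n_on A k f) x.

(** * The singular initial value problem *)

Definition singular_ivp_solution {R : realType} (n : nat) (H : R -> R)
    (d0 sstar : R) (g : R -> R) : Prop :=
  let I := `[0, sstar]%classic in
  let g1 := derive_n_on I 1 g in
  let g2 := derive_n_on I 2 g in
  [/\ smooth_on I g,
      forall s, I s -> 0 <= g s < d0,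
      g 0 = 0 &
      forall s, I s ->
        (1 - 2 * n%:R * s) * g1 s - H (g s)
        + 4 * ((s * g1 s + s ^+ 2 * g2 s) / (1 + 4 * s ^+ 2 * g1 s ^+ 2)) = 0].

Definition L2norm {R : realType} (A : set R) (f : R -> R) : \bar R :=
  Lnorm (@lebesgue_measure R) 2%:E (EFin \o (f \_ A)).

(* Main.v *)
Require Import Defs.
From HB Require Import structures.
From mathcomp Require Import all_boot all_order all_algebra.
From mathcomp Require Import all_classical all_reals all_analysis.
From mathcomp Require Import measurable_realfun ring lra.
Set Implicit Arguments.
Unset Strict Implicit.
Unset Printing Implicit Defensive.
Import Order.TTheory GRing.Theory Num.Theory.
Import numFieldNormedType.Exports.
Local Open Scope classical_set_scope.
Local Open Scope ring_scope.

(** The claim is that gamma is of Gevrey class 2 near 0, that is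
    |gamma^(j)(s)| <= A K^(j-1) ((j-1)!)^2 on some [0, s1]. Given this, the
    powers of lam produced by the rescaling beat K^j and every polynomial in j,
    so that even M = 1 and s0 = 1 will do ([gevrey_rescaled_bound]).

    Put u = gamma', u_k = u^(k) / k!, w = s u, and D = 2 n w + H(gamma) - u.
    Multiplying the equation by 1 + 4 w^2 turns it into
      4 s w' = D + 4 w^2 D.
    Its k-th Taylor coefficient reads
      4 s^2 (k+1) u_(k+1) + (4 (2k+1) s + 1) u_k
        = - 4 k u_(k-1) + 2 n w_k + H(gamma)_k + 4 (w^2 D)_k,
    and the aim is |u_k| <= A K^k k!, by induction on k. Three observations
    make this work.

    - No boundary condition is needed. At a point of [0, s1] where |u_k| is
      maximal, u_k u_(k+1) >= 0 unless that point is 0, and at 0 the factor s^2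
      kills the term. So the singular term has the good sign there, and |u_k| is
      at most the absolute value of the right-hand side. This maximum
      principle replaces any integration of the equation
      ([has_deriv_on_max_norm]). The loss of a factor k in 4 k u_(k-1) is what
      produces the second factorial.

    - Taylor coefficients of products are Cauchy products, and the weights
      K^k k! are stable under them up to a factor 3, because the sum of the
      i! (k-i)! is at most 3 k! ([cauchy_prod_bound]).

    - Everything but u_k itself is small relative to K^k k!. Indeed
      w_k = s u_k + u_(k-1) gains a factor s or 1/K, and H(gamma)_k involves
      only u_i with i < k, hence gains 1/K as well ([comp_jet_bound]). So once
      s1 and 1/K are small, u_k enters the right-hand side with a coefficient
      at most 1/2 and the rest is at most A/2 ([gevrey_step]).

    The analyticity of H enters through the bounds |H^(k) / k!| <= C rho^k near
    0 ([analytic_taylor]), which feed the recursion for the Taylor coefficients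
    of H(gamma). *)

(** * One-sided derivatives on an interval *)

(** Relational form of [derive_on]: it carries existence, so it can be handed
    from one Taylor coefficient to the next. *)
Definition has_deriv_on {R : realType} (A : set R) (f : R -> R) (x l : R) :=
  (f y - f x) / (y - x) @[y --> within (A `\ x) (nbhs x)] --> l.

Lemma has_deriv_on_subset {R : realType} (A B : set R) (f : R -> R) (x l : R) :
  B `<=` A -> has_deriv_on A f x l -> has_deriv_on B f x l.
Proof.
move=> BA; apply: cvg_trans; apply: cvg_app; apply: within_subset.
by move=> y [/BA Ay yx]; split.
Qed.

Lemma has_deriv_on_ext {R : realType} (A : set R) (f g : R -> R) (x l : R) :
  A x -> (forall y, A y -> f y = g y) ->
  has_deriv_on A f x l -> has_deriv_on A g x l.
Proof.
move=> Ax fg; apply: cvg_trans; apply: near_eq_cvg.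
rewrite near_withinE; near=> y => -[Ay _].
by rewrite !fg.
Unshelve. all: by end_near. Qed.

Lemma has_deriv_on_cvg {R : realType} (A : set R) (f : R -> R) (x l : R) :
  has_deriv_on A f x l -> f y @[y --> within (A `\ x) (nbhs x)] --> f x.
Proof.
move=> fl.
have idc : y @[y --> within (A `\ x) (nbhs x)] --> x by exact: cvg_within.
have h : f x + (f y - f x) / (y - x) * (y - x) @[y --> within (A `\ x) (nbhs x)]
    --> f x + l * (x - x).
  by apply: cvgD; [exact: cvg_cst|apply: cvgM => //; apply: cvgB => //; exact: cvg_cst].
move: h; rewrite subrr mulr0 addr0; apply: cvg_trans; apply: near_eq_cvg.
rewrite near_withinE; near=> y => -[Ay /eqP yx].
by rewrite divfK ?subr_eq0// addrC subrK.
Unshelve. all: by end_near. Qed.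

Lemma has_deriv_on_cst {R : realType} (A : set R) (c x : R) :
  has_deriv_on A (fun=> c) x 0.
Proof.
rewrite /has_deriv_on; under eq_fun do rewrite subrr mul0r.
exact: cvg_cst.
Qed.

Lemma has_deriv_on_id {R : realType} (A : set R) (x : R) :
  has_deriv_on A id x 1.
Proof.
apply: (cvg_trans (G := (fun=> 1 : R) @ within (A `\ x) (nbhs x))); last exact: cvg_cst.
apply: near_eq_cvg.
rewrite near_withinE; near=> y => -[Ay /eqP yx].
by rewrite divff ?subr_eq0.
Unshelve. all: by end_near. Qed.

Lemma has_deriv_onD {R : realType} (A : set R) (f g : R -> R) (x l m : R) :
  has_deriv_on A f x l -> has_deriv_on A g x m ->
  has_deriv_on A (fun y => f y + g y) x (l + m).
Proof.
move=> fl gm; rewrite /has_deriv_on.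
under eq_fun do rewrite opprD addrACA mulrDl.
exact: cvgD.
Qed.

Lemma has_deriv_onZ {R : realType} (A : set R) (f : R -> R) (c x l : R) :
  has_deriv_on A f x l -> has_deriv_on A (fun y => c * f y) x (c * l).
Proof.
move=> fl; rewrite /has_deriv_on.
under eq_fun do rewrite -mulrBr -mulrA.
by apply: cvgM => //; exact: cvg_cst.
Qed.

Lemma has_deriv_onM {R : realType} (A : set R) (f g : R -> R) (x l m : R) :
  has_deriv_on A f x l -> has_deriv_on A g x m ->
  has_deriv_on A (fun y => f y * g y) x (l * g x + f x * m).
Proof.
move=> fl gm; rewrite /has_deriv_on.
have -> : (fun y => (f y * g y - f x * g x) / (y - x)) =
    (fun y => (f y - f x) / (y - x) * g y + f x * ((g y - g x) / (y - x))).
  by apply/funext => y; ring.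
apply: cvgD; apply: cvgM => //; first exact: has_deriv_on_cvg gm.
exact: cvg_cst.
Qed.

Lemma has_deriv_on_sum {R : realType} (A : set R) (I : Type) (r : seq I)
    (f : I -> R -> R) (x : R) (l : I -> R) :
  (forall i, has_deriv_on A (f i) x (l i)) ->
  has_deriv_on A (fun y => \sum_(i <- r) f i y) x (\sum_(i <- r) l i).
Proof.
move=> fl; elim: r => [|i r IH].
  rewrite big_nil; under eq_fun do rewrite big_nil; exact: has_deriv_on_cst.
rewrite big_cons; under eq_fun do rewrite big_cons; exact: has_deriv_onD.
Qed.

Lemma has_deriv_on_comp {R : realType} (A : set R) (F f : R -> R) (x l m : R) :
  is_derive (f x) (1 : R) F m -> has_deriv_on A f x l ->
  has_deriv_on A (F \o f) x (m * l).
Proof.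
move=> [dF Fm] fl.
(* Difference quotient of F, continuous at f x: no division by f y - f x,
   which may vanish for y near x. *)
pose q z := if z == f x then m else (F z - F (f x)) / (z - f x).
have qE z : F z - F (f x) = q z * (z - f x).
  rewrite /q; case: eqP => [->|/eqP zx]; first by rewrite !subrr mulr0.
  by rewrite divfK ?subr_eq0.
have qc : q z @[z --> f x] --> m.
  have : h^-1 *: (F (h *: 1 + f x) - F (f x)) @[h --> 0^'] --> m.
    by rewrite -Fm; exact: dF.
  move=> /cvgrPdist_lt dm; apply/cvgrPdist_lt => e e0.
  have := dm e e0; rewrite /dnbhs /= near_withinE => /nbhs_ballP[d /= d0 dP].
  apply/nbhs_ballP; exists d => //= z; rewrite /ball /= => zd.
  rewrite /q; case: eqP => [_|/eqP zx]; first by rewrite subrr normr0.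
  have := dP (z - f x); rewrite /ball/= sub0r normrN distrC => /(_ zd).
  by rewrite subr_eq0 => /(_ zx); rewrite [_ *: 1]mulr1 subrK [_ *: _]mulrC.
rewrite /has_deriv_on /=.
under eq_fun do rewrite qE -mulrA.
apply: cvgM => //; apply: cvg_comp qc; exact: has_deriv_on_cvg fl.
Qed.

Lemma has_deriv_on_scale {R : realType} (A B : set R) (c : R) (f : R -> R) (x l : R) :
  c != 0 -> (forall y, B y -> A (c * y)) -> has_deriv_on A f (c * x) l ->
  has_deriv_on B (fun y => f (c * y)) x (c * l).
Proof.
move=> c0 BA fl; rewrite /has_deriv_on.
have h : c * ((f (c * y) - f (c * x)) / (c * y - c * x))
    @[y --> within (B `\ x) (nbhs x)] --> c * l.
  apply: cvgM; first exact: cvg_cst.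
  apply: (cvg_comp (fun y => c * y) (fun z => (f z - f (c * x)) / (z - c * x))) fl.
  move=> P HP; have H : \forall y \near x, (A `\ (c * x)) (c * y) -> P (c * y).
    exact: (@mulrl_continuous R c x _ HP).
  rewrite /= /within /=; apply: filterS H => y Hy [By yx]; apply: Hy.
  by split; [exact: BA|move=> /(mulfI c0)].
move: h; apply: cvg_trans; apply: near_eq_cvg.
rewrite near_withinE; near=> y => _.
by rewrite -mulrBr invfM mulrCA mulVKf.
Unshelve. all: by end_near. Qed.

Lemma closure_itvcc_punctured {R : realType} (a b x : R) :
  a < b -> a <= x <= b -> closure (`[a, b]%classic `\ x) x.
Proof.
move=> ab /andP[ax xb] B /nbhs_ballP[e /= e0 eB].
have [xltb|bx] := ltP x b.
- exists (x + Num.min (e / 2) (b - x)).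
  have m0 : 0 < Num.min (e / 2) (b - x) by rewrite lt_min; apply/andP; split; lra.
  have m1 : Num.min (e / 2) (b - x) <= e / 2 by rewrite ge_min lexx.
  have m2 : Num.min (e / 2) (b - x) <= b - x by rewrite ge_min lexx orbT.
  move: (Num.min _ _) m0 m1 m2 => m m0 m1 m2; split.
    by split; [rewrite /= in_itv/=; lra|move=> /=; lra].
  by apply: eB; rewrite /ball /= opprD addNKr normrN gtr0_norm//; lra.
- exists (x - Num.min (e / 2) (x - a)).
  have m0 : 0 < Num.min (e / 2) (x - a) by rewrite lt_min; apply/andP; split; lra.
  have m1 : Num.min (e / 2) (x - a) <= e / 2 by rewrite ge_min lexx.
  have m2 : Num.min (e / 2) (x - a) <= x - a by rewrite ge_min lexx orbT.
  move: (Num.min _ _) m0 m1 m2 => m m0 m1 m2; split.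
    by split; [rewrite /= in_itv/=; lra|move=> /=; lra].
  by apply: eB; rewrite /ball /= subKr gtr0_norm//; lra.
Qed.

Lemma has_deriv_on_unique {R : realType} (a b : R) (f : R -> R) (x l m : R) :
  a < b -> a <= x <= b ->
  has_deriv_on `[a, b] f x l -> has_deriv_on `[a, b] f x m -> l = m.
Proof.
move=> ab axb fl fm; have P := within_nbhs_proper (closure_itvcc_punctured ab axb).
exact: (cvg_unique _ fl fm).
Qed.

Lemma has_deriv_on_derive {R : realType} (a b : R) (f : R -> R) (x l : R) :
  a < b -> a <= x <= b -> has_deriv_on `[a, b] f x l ->
  derive_on `[a, b] f x = l.
Proof.
move=> ab axb fl; have P := within_nbhs_proper (closure_itvcc_punctured ab axb).
exact: cvg_lim fl.
Qed.

Lemma has_deriv_on_continuous {R : realType} (A : set R) (f d : R -> R) :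
  (forall x, A x -> has_deriv_on A f x (d x)) -> {within A, continuous f}.
Proof.
move=> fd; apply/subspace_continuousP => x Ax.
have := has_deriv_on_cvg (fd x Ax) => fx.
move=> P Px.
have H : \forall y \near x, (A `\ x) y -> P (f y) by exact: fx P Px.
change (\forall y \near x, A y -> P (f y)).
apply: filterS H => y Hy Ay; have [->|yx] := eqVneq y x.
  exact: nbhs_singleton.
by apply: Hy; split => //; apply/eqP.
Qed.

(** The maximum principle. For y < x the difference quotient times f x is
    nonnegative, since f y * f x <= `|f x| ^ 2; only points to the left of x
    are used, so x may be the right end point. *)
Lemma has_deriv_on_max_norm {R : realType} (a b : R) (f : R -> R) (x l : R) :
  a < x <= b -> (forall y, a <= y <= b -> `|f y| <= `|f x|) ->
  has_deriv_on `[a, b] f x l -> 0 <= f x * l.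
Proof.
move=> /andP[ax xb] fmax fl.
have axx : a <= x <= x by rewrite lexx ltW.
have P := within_nbhs_proper (closure_itvcc_punctured ax axx).
have {}fl : has_deriv_on `[a, x] f x l.
  apply: has_deriv_on_subset fl => y /=; rewrite !in_itv /= => /andP[-> yx] /=.
  exact: le_trans yx xb.
have h : f x * ((f y - f x) / (y - x)) @[y --> within (`[a, x] `\ x) (nbhs x)] --> f x * l.
  by apply: cvgM => //; exact: cvg_cst.
rewrite -(cvg_lim _ h)//; apply: limr_ge; first by apply/cvg_ex; exists (f x * l).
rewrite near_withinE; near=> y => -[] /=; rewrite in_itv /= => /andP[ay yx] /eqP nyx.
rewrite mulrA -mulrNN mulr_ge0//; last first.
  by rewrite oppr_ge0 invr_le0 subr_le0.
rewrite oppr_ge0 mulrBr subr_le0 (le_trans (ler_norm _))// normrM.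
rewrite -[f x * f x]ger0_norm -?expr2 ?sqr_ge0//.
by rewrite expr2 normrM ler_wpM2l// fmax// ay (le_trans yx).
Unshelve. all: by end_near. Qed.

(** * Jets: sequences of Taylor coefficients *)

Definition cauchy_prod {R : realType} (a b : nat -> R) (k : nat) : R :=
  \sum_(i < k.+1) a i * b (k - i)%N.

(** The function f k stands for the k-th derivative of f 0 divided by k!; this
    normalization turns the Leibniz rule into a plain Cauchy product. *)
Definition taylor_jet {R : realType} (A : set R) (f : nat -> R -> R) :=
  forall k x, A x -> has_deriv_on A (f k) x (k.+1%:R * f k.+1 x).

Lemma has_deriv_on_cauchy_prod {R : realType} (A : set R) (f g : nat -> R -> R)
    (k : nat) (x : R) :
  (forall i, (i <= k)%N -> has_deriv_on A (f i) x (i.+1%:R * f i.+1 x)) ->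
  (forall i, (i <= k)%N -> has_deriv_on A (g i) x (i.+1%:R * g i.+1 x)) ->
  has_deriv_on A (fun y => cauchy_prod (f^~ y) (g^~ y) k) x
    (k.+1%:R * cauchy_prod (f^~ x) (g^~ x) k.+1).
Proof.
move=> fd gd.
pose l (i : 'I_k.+1) := i.+1%:R * f i.+1 x * g (k - i)%N x +
   f i x * ((k - i).+1%:R * g (k - i).+1 x).
have -> : k.+1%:R * cauchy_prod (f^~ x) (g^~ x) k.+1 = \sum_(i < k.+1) l i.
  rewrite /l big_split /= /cauchy_prod mulr_sumr.
  transitivity (\sum_(i < k.+2) (i%:R * f i x * g (k.+1 - i)%N x
     + f i x * ((k.+1 - i)%:R * g (k.+1 - i)%N x))).
    apply: eq_bigr => i _.
    have -> : k.+1%:R = i%:R + (k.+1 - i)%:R :> R by rewrite -natrD subnKC// -ltnS.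
    by ring.
  rewrite big_split /=; congr (_ + _).
    by rewrite big_ord_recl mul0r mul0r add0r; apply: eq_bigr => i _; rewrite lift0 subSS.
  rewrite big_ord_recr /= subnn mul0r mulr0 addr0; apply: eq_bigr => i _.
  by rewrite subSn// -ltnS.
apply: has_deriv_on_sum => i; apply: has_deriv_onM.
  by apply: fd; rewrite -ltnS.
by apply: gd; rewrite leq_subr.
Qed.

Lemma taylor_jet_cauchy_prod {R : realType} (A : set R) (f g : nat -> R -> R) :
  taylor_jet A f -> taylor_jet A g ->
  taylor_jet A (fun k x => cauchy_prod (f^~ x) (g^~ x) k).
Proof. by move=> fj gj k x Ax; apply: has_deriv_on_cauchy_prod => i _; [exact: fj|exact: gj]. Qed.

Lemma taylor_jetD {R : realType} (A : set R) (f g : nat -> R -> R) :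
  taylor_jet A f -> taylor_jet A g -> taylor_jet A (fun k x => f k x + g k x).
Proof.
by move=> fj gj k x Ax; rewrite mulrDr; apply: has_deriv_onD; [exact: fj|exact: gj].
Qed.

Lemma taylor_jetZ {R : realType} (A : set R) (c : R) (f : nat -> R -> R) :
  taylor_jet A f -> taylor_jet A (fun k x => c * f k x).
Proof. by move=> fj k x Ax; rewrite mulrCA; apply: has_deriv_onZ; exact: fj. Qed.

Lemma taylor_jetB {R : realType} (A : set R) (f g : nat -> R -> R) :
  taylor_jet A f -> taylor_jet A g -> taylor_jet A (fun k x => f k x - g k x).
Proof.
move=> fj gj k x Ax; rewrite mulrBr.
have := has_deriv_onD (fj k x Ax) (has_deriv_onZ (c := -1) (gj k x Ax)).
rewrite mulN1r; congr (has_deriv_on _ _ _ _).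
by apply/funext => y; rewrite mulN1r.
Qed.

Lemma taylor_jet_derive {R : realType} (A : set R) (f : nat -> R -> R) :
  taylor_jet A f -> taylor_jet A (fun k x => k.+1%:R * f k.+1 x).
Proof. by move=> fj k x Ax; apply: has_deriv_onZ; exact: fj. Qed.

(** The jet of s * f(s) at s, from the jet a of f. *)
Definition mul_var {R : realType} (s : R) (a : nat -> R) (k : nat) : R :=
  s * a k + (if k is j.+1 then a j else 0).

Lemma taylor_jet_mul_var {R : realType} (A : set R) (f : nat -> R -> R) :
  taylor_jet A f -> taylor_jet A (fun k x => mul_var x (f^~ x) k).
Proof.
move=> fj k x Ax; rewrite /mul_var.
have -> : k.+1%:R * (x * f k.+1 x + f k x) =
    1 * f k x + id x * (k.+1%:R * f k.+1 x) +
    (if k is j.+1 then k%:R * f k x else 0).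
  by case: k => [|k]; [|rewrite -natr1]; ring.
apply: has_deriv_onD; first by apply: has_deriv_onM; [exact: has_deriv_on_id|exact: fj].
case: k => [|k]; [exact: has_deriv_on_cst|exact: fj].
Qed.

(** An equation that holds on an interval may be differentiated any number of
    times, at the end points too. *)
Lemma taylor_jet_eq0 {R : realType} (a b : R) (f : nat -> R -> R) :
  a < b -> taylor_jet `[a, b] f -> (forall x, `[a, b]%classic x -> f 0 x = 0) ->
  forall k x, `[a, b]%classic x -> f k x = 0.
Proof.
move=> ab fj f0; elim=> // k IH x Ix.
have axb : a <= x <= b by move: Ix; rewrite /= in_itv.
apply: (mulfI (x := k.+1%:R)); first by rewrite pnatr_eq0.
rewrite mulr0; apply: (has_deriv_on_unique ab axb (fj k x Ix)).
apply: has_deriv_on_ext (has_deriv_on_cst _ 0 _) => // y Iy.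
by rewrite IH.
Qed.

(** * Gevrey weights and Cauchy products *)

Lemma leq_fact_pred (i j : nat) : (i.+1`! * j.+1`! <= (i + j).+1`!)%N.
Proof.
elim: i => [|i IH]; first by rewrite mul1n.
rewrite (factS i.+1) -mulnA (leq_trans (leq_mul (leqnn _) IH))//.
by rewrite addSn (factS (i + j).+1) leq_mul// !ltnS leq_addr.
Qed.

(** For 0 < k both extreme terms are k!, and each of the k - 1 others is at most (k-1)!
    by [leq_fact_pred]. *)
Lemma leq_sum_fact (k : nat) : (\sum_(i < k.+1) i`! * (k - i)`! <= 3 * k`!)%N.
Proof.
case: k => [|k]; first by rewrite big_ord1.
rewrite big_ord_recl big_ord_recr /= subn0 subnn mul1n muln1.
rewrite (_ : (_ * _ = k.+1`! + (k.+1`! + k.+1`!))%N); last by rewrite !mulSn addn0.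
rewrite leq_add2l addnC leq_add2l.
apply: leq_trans (_ : (\sum_(i < k) k`! <= _)%N).
  apply: leq_sum => i _; rewrite /= /bump leq0n add1n subSS.
  have -> : (k - i = (k - i.+1).+1)%N by rewrite subnS prednK// subn_gt0.
  rewrite (leq_trans (leq_fact_pred _ _))//.
  by rewrite -addnS addnC -subSn// subSS addnC subnKC// ltnW.
by rewrite sum_nat_const card_ord factS leq_mul.
Qed.

Definition gevrey_weight {R : realType} (K : R) (k : nat) : R := K ^+ k * k`!%:R.

Lemma gevrey_weight_gt0 {R : realType} (K : R) (k : nat) :
  0 < K -> 0 < gevrey_weight K k.
Proof. by move=> K0; rewrite mulr_gt0 ?exprn_gt0// ltr0n fact_gt0. Qed.

Lemma gevrey_weightS {R : realType} (K : R) (k : nat) :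
  gevrey_weight K k.+1 = K * k.+1%:R * gevrey_weight K k.
Proof. by rewrite /gevrey_weight exprS factS natrM; ring. Qed.

Lemma sum_gevrey_weight {R : realType} (K : R) (k : nat) : 0 < K ->
  cauchy_prod (gevrey_weight K) (gevrey_weight K) k <= 3 * gevrey_weight K k.
Proof.
move=> K0; rewrite /cauchy_prod.
have -> : \sum_(i < k.+1) gevrey_weight K i * gevrey_weight K (k - i)%N
    = K ^+ k * (\sum_(i < k.+1) i`! * (k - i)`!)%N%:R.
  rewrite natr_sum mulr_sumr; apply: eq_bigr => i _.
  have ik : (i <= k)%N by rewrite -ltnS.
  by rewrite /gevrey_weight natrM mulrACA -exprD subnKC.
rewrite /gevrey_weight mulrCA ler_wpM2l ?exprn_ge0 ?(ltW K0)//.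
by rewrite -natrM ler_nat leq_sum_fact.
Qed.

(** The last coefficients may exceed the weights, by x and y. As 0 < k, a k and
    b k are not multiplied with each other, so that the bound is only linear in
    the excesses; this is what permits to absorb them. *)
Lemma cauchy_prod_bound_excess {R : realType} (K p q x y : R) (a b : nat -> R) (k : nat) :
  0 < K -> 0 <= x -> 0 <= y -> (0 < k)%N ->
  (forall i, (i < k)%N -> `|a i| <= p * gevrey_weight K i) ->
  (forall i, (i < k)%N -> `|b i| <= q * gevrey_weight K i) ->
  `|a k| <= (p + x) * gevrey_weight K k ->
  `|b k| <= (q + y) * gevrey_weight K k ->
  `|cauchy_prod a b k| <= (3 * p * q + p * y + x * q) * gevrey_weight K k.
Proof.
move=> K0 x0 y0 k0 ha hb hak hbk.
have W i := gevrey_weight_gt0 i K0.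
have W0 : gevrey_weight K 0 = 1 by rewrite /gevrey_weight mul1r.
have p0 : 0 <= p by have := ha 0%N k0; rewrite W0 mulr1; exact: le_trans.
have q0 : 0 <= q by have := hb 0%N k0; rewrite W0 mulr1; exact: le_trans.
set w := gevrey_weight K in ha hb hak hbk W W0 *.
apply: (le_trans (ler_norm_sum _ _ _)).
apply: (@le_trans _ _ (\sum_(i < k.+1) (p * q * (w i * w (k - i)%N)
   + ((if i == ord0 then p * y * w k else 0) + (if i == ord_max then x * q * w k else 0))))).
  apply: ler_sum => i _; rewrite normrM.
  have [->|i0] := eqVneq i ord0.
    rewrite subn0 ifF; last by rewrite -val_eqE /= eqn_leq leqn0; case: (k) k0.
    rewrite W0 mul1r addr0 (_ : _ + _ = p * ((q + y) * w k)); last by ring.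
    by rewrite ler_pM// -[p]mulr1 -W0 ha.
  have [->|ik] := eqVneq i ord_max.
    rewrite /= subnn W0 mulr1 add0r (_ : _ + _ = (p + x) * w k * q); last by ring.
    by rewrite ler_pM// -[q]mulr1 -W0 hb.
  rewrite !addr0 (_ : p * q * _ = (p * w i) * (q * w (k - i)%N)); last by ring.
  have i0' : (0 < i)%N by rewrite lt0n; move: i0; rewrite -val_eqE.
  have ik' : (i < k)%N.
    by move: ik; rewrite -val_eqE /= => ik; rewrite ltn_neqAle ik -ltnS ltn_ord.
  by rewrite ler_pM// ?ha ?hb// ltn_subrL i0'.
rewrite big_split /= big_split /= -!big_mkcond /= !big_pred1_eq -mulr_sumr.
have := sum_gevrey_weight k K0; rewrite /cauchy_prod -/w => h.
have := ler_wpM2l (mulr_ge0 p0 q0) h.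
by move: (\sum_(i < k.+1) _) => S; lra.
Qed.

Lemma cauchy_prod_bound {R : realType} (K p q : R) (a b : nat -> R) (k : nat) :
  0 < K ->
  (forall i, (i <= k)%N -> `|a i| <= p * gevrey_weight K i) ->
  (forall i, (i <= k)%N -> `|b i| <= q * gevrey_weight K i) ->
  `|cauchy_prod a b k| <= 3 * p * q * gevrey_weight K k.
Proof.
move=> K0 ha hb.
have W0 : gevrey_weight K 0 = 1 by rewrite /gevrey_weight mul1r.
case: k ha hb => [|k] ha hb.
  have := ha 0%N isT; have := hb 0%N isT.
  rewrite W0 !mulr1 /cauchy_prod big_ord1 normrM => hb0 ha0.
  have p0 : 0 <= p by exact: le_trans ha0.
  have q0 : 0 <= q by exact: le_trans hb0.
  rewrite (le_trans (ler_pM _ _ ha0 hb0))//.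
  by rewrite -mulrA ler_peMl ?mulr_ge0// ler1n.
have := @cauchy_prod_bound_excess _ K p q 0 0 a b k.+1 K0 (lexx _) (lexx _) isT.
rewrite mulr0 mul0r !addr0; apply=> //.
- by move=> i ik; rewrite ha// ltnW.
- by move=> i ik; rewrite hb// ltnW.
- exact: ha.
- exact: hb.
Qed.

(** * Composition with an analytic function *)

Lemma leq_bin_exp2 (n k : nat) : ('C(n, k) <= 2 ^ n)%N.
Proof.
elim: n k => [|n IH] [|k]; rewrite ?bin0 ?expn_gt0// binS expnS mul2n -addnn.
by rewrite leq_add.
Qed.

Lemma pseries_bounded_coef {R : realType} (a : R^nat) (y : R) :
  cvgn (pseries a y) -> exists2 M, 0 <= M & forall m, `|a m| * `|y| ^+ m <= M.
Proof.
move=> /cvg_series_bounded[M [Mr HM]].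
exists (`|M| + 1) => [|m]; first by rewrite addr_ge0.
rewrite -normrX -normrM; apply: HM => //.
by rewrite (le_lt_trans (ler_norm _))// ltrDl.
Qed.

(** If the series converges at y with terms bounded by M, then F k, the sum of
    the 'C(m+k, k) a_(m+k) x^m, is dominated on `|x| <= y / 4 by a geometric
    series of ratio 1/2, because 'C(m+k, k) <= 2^(m+k). This gives at once the
    termwise differentiability and the bound with rho = 2 / y. *)
Lemma analytic_taylor {R : realType} (H : R -> R) : real_analytic_at H 0 ->
  exists (F : nat -> R -> R) (C r rho : R),
    [/\ 1 <= C, 0 < r, 0 < rho &
     forall x, `|x| < r -> [/\ F 0%N x = H x,
       forall k, is_derive x (1 : R) (F k) (k.+1%:R * F k.+1 x) &
       forall k, `|F k x| <= C * rho ^+ k]].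
Proof.
move=> [a] /nbhs_ballP[e /= e0 aH].
pose y := e / 2.
have y0 : 0 < y by rewrite divr_gt0.
have [M M0 aM] : exists2 M, 0 <= M & forall m, `|a m| * `|y| ^+ m <= M.
  apply: pseries_bounded_coef; apply/cvg_ex; exists (H y); rewrite -{1}[y]subr0.
  by apply: aH; rewrite /ball /= sub0r normrN gtr0_norm// /y; lra.
pose rho := 2 / y; pose r := y / 4.
have rho0 : 0 < rho by rewrite divr_gt0.
have r0 : 0 < r by rewrite divr_gt0.
pose b k m := 'C(m + k, k)%:R * a (m + k)%N.
have bM k m : `|b k m| <= M * rho ^+ (m + k).
  rewrite /b normrM normr_nat /rho exprMn exprVn.
  have := aM (m + k)%N; rewrite (gtr0_norm y0) -ler_pdivlMr ?exprn_gt0// => h.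
  rewrite (mulrCA M) ler_pM// -natrX ler_nat.
  by rewrite leq_bin_exp2.
have geo k x m : `|x| <= r -> `|b k m * x ^+ m| <= geometric (M * rho ^+ k) (1 / 2) m.
  move=> xr; rewrite normrM normrX /geometric /=.
  have -> : (1 / 2 : R) = rho * r by rewrite /rho /r; field; rewrite gt_eqF.
  have -> : M * rho ^+ k * (rho * r) ^+ m = M * rho ^+ (m + k) * r ^+ m.
    by rewrite (exprMn m rho r) exprD -!mulrA (mulrCA (rho ^+ k)).
  by rewrite ler_pM// lerXn2r// nnegrE// ltW.
have half1 : `|1 / 2 : R| < 1 by rewrite ger0_norm; lra.
have gcv k : cvgn (series (geometric (M * rho ^+ k) (1 / 2))) by exact: is_cvg_geometric_series.
have ncv k x : `|x| <= r -> cvgn [normed pseries (b k) x].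
  move=> xr; apply: (series_le_cvg _ _ _ (gcv k)) => m.
  - exact: normr_ge0.
  - by rewrite mulr_ge0 ?exprn_ge0// mulr_ge0// exprn_ge0// ltW.
  - exact: geo.
have cv k x : `|x| <= r -> cvgn (pseries (b k) x) by move=> /(ncv k) h; exact: (normed_cvg h).
have diffs k : pseries_diffs (b k) = k.+1%:R *: b k.+1.
  apply/funext => m; rewrite /pseries_diffs /b /= [RHS]mulrA mulrA.
  rewrite addSnnS; congr (_ * _); rewrite -!natrM; congr (_%:R).
  by rewrite mul_bin_left addnS -addSn addnK.
have pseriesZ c (d : R^nat) x : pseries (c *: d) x = c *: pseries d x.
  apply/funext => m; rewrite /pseries /series /= [RHS]mulr_sumr.
  by apply: eq_bigr => i _; rewrite mulrA.
exists (fun k x => limn (pseries (b k) x)), (Num.max 1 (2 * M)), r, rho; split => //.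
  by rewrite le_max lexx.
move=> x xr; split.
- apply/cvg_lim => //; rewrite -[X in pseries _ X]subr0.
  have -> : b 0%N = a by apply/funext => m; rewrite /b addn0 bin0 mul1r.
  apply: aH; rewrite /ball /= sub0r normrN (lt_trans xr)// /r /y; lra.
- move=> k.
  have -> : k.+1%:R * limn (pseries (b k.+1) x) = limn (pseries (pseries_diffs (b k)) x).
    rewrite diffs pseriesZ limZl_tmp//; apply: cv; exact: ltW.
  have rr : `|r| <= r by rewrite gtr0_norm.
  apply: (@pseries_snd_diffs _ _ r).
  + exact: cv.
  + by rewrite diffs pseriesZ; apply: is_cvgZl_tmp; exact: cv.
  + rewrite diffs.
    have -> : pseries_diffs (k.+1%:R *: b k.+1) = k.+1%:R *: pseries_diffs (b k.+1).
      by apply/funext => m; rewrite /pseries_diffs /= mulrCA.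
    by rewrite diffs !pseriesZ; do 2!apply: is_cvgZl_tmp; exact: cv.
  + by rewrite (gtr0_norm r0).
- move=> k; have xr' := ltW xr.
  apply: (le_trans (lim_series_norm (ncv k x xr'))).
  apply: (@le_trans _ _ (M * rho ^+ k * (1 - 1 / 2)^-1)).
    rewrite -(cvg_lim _ (@cvg_geometric_series _ (M * rho ^+ k) _ half1))//.
    by apply: lim_series_le => //; [exact: ncv|move=> m; exact: geo].
  have -> : M * rho ^+ k * (1 - 1 / 2)^-1 = 2 * M * rho ^+ k by field.
  by rewrite ler_wpM2r ?exprn_ge0 ?(ltW rho0)// le_max lexx orbT.
Qed.

(** The Taylor coefficients of F k \o g, when F is a jet and u is the jet of the
    derivative of g: from (F k \o g)' = k.+1 * (F k.+1 \o g) * g', the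
    coefficient j + 1 for k is a Cauchy product of the coefficients up to j for
    k + 1. That recursion is course-of-values, whence the index j up to which
    the coefficients are correct; it avoids the formula of Faa di Bruno. *)
Fixpoint comp_jet_upto {R : realType} (F : nat -> R -> R) (g : R -> R)
    (u : nat -> R -> R) (j : nat) : nat -> nat -> R -> R :=
  if j is j'.+1 then fun k i x =>
    if (i <= j')%N then comp_jet_upto F g u j' k i x
    else k.+1%:R / j'.+1%:R *
         cauchy_prod (fun l => comp_jet_upto F g u j' k.+1 l x) (u^~ x) j'
  else fun k _ x => F k (g x).

Definition comp_jet {R : realType} (F : nat -> R -> R) (g : R -> R)
    (u : nat -> R -> R) (k j : nat) : R -> R := comp_jet_upto F g u j k j.

Lemma comp_jet_uptoE {R : realType} (F : nat -> R -> R) (g : R -> R)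
    (u : nat -> R -> R) (k i j : nat) (x : R) :
  (i <= j)%N -> comp_jet_upto F g u j k i x = comp_jet F g u k i x.
Proof.
elim: j => [|j IH]; first by rewrite leqn0 => /eqP ->.
by rewrite leq_eqVlt => /predU1P[->//|]; rewrite ltnS /= => ij; rewrite ij IH.
Qed.

Lemma eq_cauchy_prod {R : realType} (a a' b b' : nat -> R) (k : nat) :
  (forall i, (i <= k)%N -> a i = a' i) -> (forall i, (i <= k)%N -> b i = b' i) ->
  cauchy_prod a b k = cauchy_prod a' b' k.
Proof.
move=> aa bb; apply: eq_bigr => i _; rewrite aa ?bb// ?leq_subr//.
by rewrite -ltnS.
Qed.

Lemma comp_jetS {R : realType} (F : nat -> R -> R) (g : R -> R)
    (u : nat -> R -> R) (k j : nat) (x : R) :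
  comp_jet F g u k j.+1 x = k.+1%:R / j.+1%:R *
    cauchy_prod (fun l => comp_jet F g u k.+1 l x) (u^~ x) j.
Proof.
rewrite {1}/comp_jet /= ltnn; congr (_ * _); apply: eq_cauchy_prod => // i ij.
exact: comp_jet_uptoE.
Qed.

Lemma taylor_jet_comp {R : realType} (A : set R) (F : nat -> R -> R) (g : R -> R)
    (u : nat -> R -> R) :
  (forall k x, A x -> is_derive (g x) (1 : R) (F k) (k.+1%:R * F k.+1 (g x))) ->
  (forall x, A x -> has_deriv_on A g x (u 0%N x)) -> taylor_jet A u ->
  forall k, taylor_jet A (comp_jet F g u k).
Proof.
move=> Fd gd uj k j x Ax; elim/ltn_ind: j k => -[|j] IH k.
  rewrite mul1r comp_jetS /cauchy_prod big_ord1 subnn divr1 mulrA.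
  by apply: has_deriv_on_comp; [exact: Fd|exact: gd].
have -> : comp_jet F g u k j.+1 = (fun y => k.+1%:R / j.+1%:R *
    cauchy_prod (fun l => comp_jet F g u k.+1 l y) (u^~ y) j).
  by apply/funext => y; exact: comp_jetS.
have -> : j.+2%:R * comp_jet F g u k j.+2 x = k.+1%:R / j.+1%:R *
    (j.+1%:R * cauchy_prod (fun l => comp_jet F g u k.+1 l x) (u^~ x) j.+1).
  rewrite comp_jetS !mulrA; congr (_ * _).
  by rewrite divfK ?pnatr_eq0// mulrAC divff ?pnatr_eq0// mul1r.
apply/has_deriv_onZ/has_deriv_on_cauchy_prod => i ij; last exact: uj.
exact: IH.
Qed.

(** The binomial coefficient is exactly reproduced by the recursion, since
    k.+1 / j.+1 * 'C(k.+1 + j, j) = 'C(k + j.+1, j.+1). The second bound is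
    sharper than the first by a factor of order K: the coefficient j + 1 depends on a
    only up to index j. *)
Lemma comp_jet_bound {R : realType} (K A C rho : R) (N : nat) (a : nat -> R)
    (c : nat -> nat -> R) :
  0 < K -> 0 <= A -> 0 <= C -> 0 <= rho -> 3 * A * rho <= K ->
  (forall i, (i <= N)%N -> `|a i| <= A * gevrey_weight K i) ->
  (forall k, `|c k 0%N| <= C * rho ^+ k) ->
  (forall k j, c k j.+1 = k.+1%:R / j.+1%:R * cauchy_prod (c k.+1) a j) ->
  (forall k j, (j <= N.+1)%N ->
    `|c k j| <= C * rho ^+ k * 'C(k + j, j)%:R * gevrey_weight K j) /\
  (forall j, (j <= N)%N ->
    `|c 0%N j.+1| <= C * (3 * A * rho) * gevrey_weight K j).
Proof.
move=> K0 A0 C0 r0 AK ha c0 cS.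
have W i : 0 <= gevrey_weight K i by exact/ltW/gevrey_weight_gt0.
have step k j : (j <= N)%N -> (forall i, (i <= j)%N ->
    `|c k.+1 i| <= C * rho ^+ k.+1 * 'C(k.+1 + i, i)%:R * gevrey_weight K i) ->
  `|c k j.+1| <= C * rho ^+ k * 'C(k + j.+1, j.+1)%:R * (3 * A * rho * gevrey_weight K j).
  move=> jN hc; rewrite cS normrM ger0_norm ?divr_ge0//.
  have h := @cauchy_prod_bound _ K (C * rho ^+ k.+1 * 'C(k.+1 + j, j)%:R) A (c k.+1) a j K0.
  apply: (le_trans (ler_wpM2l _ (h _ _))); first by rewrite divr_ge0.
  - move=> i ij; apply: (le_trans (hc i ij)); rewrite ler_wpM2r//.
    rewrite ler_wpM2l ?mulr_ge0 ?exprn_ge0// ler_nat.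
    rewrite -[X in (X <= _)%N]bin_sub ?leq_addl// addnK.
    rewrite -[X in (_ <= X)%N]bin_sub ?leq_addl// addnK.
    by rewrite leq_bin2l// leq_add2l.
  - by move=> i ij; apply: ha; exact: leq_trans ij jN.
  rewrite addnS -addSn.
  have -> : 'C(k.+1 + j, j.+1)%:R = k.+1%:R / j.+1%:R * 'C(k.+1 + j, j)%:R :> R.
    have := mul_bin_left (k.+1 + j) j; rewrite addnK => /(congr1 (fun z => z%:R : R)).
    by rewrite !natrM => E2; rewrite mulrAC -E2 mulrAC divff ?pnatr_eq0// mul1r.
  by rewrite exprS le_eqVlt; apply/orP; left; apply/eqP; ring.
have main j : (j <= N.+1)%N -> forall k,
    `|c k j| <= C * rho ^+ k * 'C(k + j, j)%:R * gevrey_weight K j.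
  elim/ltn_ind: j => -[|j] IH jN k.
    by rewrite addn0 bin0 mulr1 /gevrey_weight !mulr1.
  apply: (le_trans (step k j jN _)).
    by move=> i ij; apply: IH => //; rewrite (leq_trans ij)// ltnW.
  rewrite ler_wpM2l ?mulr_ge0 ?exprn_ge0// gevrey_weightS ler_wpM2r//.
  by rewrite (le_trans AK)// ler_peMr ?ler1n// ltW.
split; first by move=> k j jN; exact: main.
move=> j jN; have := step 0%N j jN; rewrite expr0 mulr1 add0n binn mulr1 mulrA; apply.
by move=> i ij; apply: main; rewrite (leq_trans ij)// ltnW.
Qed.

(** * The Gevrey estimate *)

(** Collects the contributions to the bound of u_k in [gevrey_step]: Y is the
    size of u_k relative to its weight, and for d small it appears on the right
    with a coefficient at most 1/2. *)
Lemma absorb_excess {R : realType} (n s A C d Y : R) :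
  1 <= n -> 1 <= A -> 1 <= C -> 0 <= s -> 2 * A * s <= d ->
  0 < d -> 100 * (2 * n + C + A) * d <= 1 -> 0 <= Y ->
  let B := 2 * n * d + C + A in
  Y <= 2 * n * (d + s * Y) + d
       + 4 * (3 * (3 * d * d) * B + 3 * d * d * ((2 * n * s + 1) * Y)
              + (2 * d * (s * Y)) * B) + 2 * d ->
  Y <= A.
Proof.
move=> n1 A1 C1 s0 As d0 dsmall Y0 B.
have nd0 : 0 <= n * d by apply: mulr_ge0; lra.
have Cd0 : d <= C * d by rewrite ler_peMl//; lra.
have Ad0 : d <= A * d by rewrite ler_peMl//; lra.
have nd1 : d <= n * d by rewrite ler_peMl//; lra.
have d1 : d <= 1 / 400 by lra.
have nd : n * d <= 1 / 200 by lra.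
have As1 : s <= A * s by rewrite ler_peMl.
have sd : s <= d / 2 by lra.
have nd2 : n * d <= n by rewrite ler_piMr//; lra.
have B0 : 0 <= B by rewrite /B; lra.
have Bd : B * d <= 1 / 100.
  have : d * B <= d * (2 * n + C + A).
    by rewrite ler_wpM2l /B//; lra.
  lra.
have ns : n * s <= 1 / 400.
  have : n * s <= n * (d / 2) by rewrite ler_wpM2l//; lra.
  lra.
have Bdd : B * d * d <= 1 / 100 * (1 / 400)
  by rewrite ler_pM// ?mulr_ge0//; lra.
have Bds : B * d * s <= 1 / 100 * (1 / 800) by rewrite ler_pM// ?mulr_ge0//; lra.
have dd : d * d <= 1 / 400 * (1 / 400) by rewrite ler_pM//; lra.
have dd0 := mulr_ge0 (ltW d0) (ltW d0).
have ns0 : 0 <= n * s by rewrite mulr_ge0// (le_trans ler01).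
have ddns : d * d * (n * s) <= 1 / 400 * (1 / 400) * (1 / 400) by rewrite ler_pM.
clearbody B.
pose c := 2 * (n * s) + 12 * (2 * (d * d * (n * s)) + d * d) + 8 * (B * d * s).
have c1 : c <= 1 / 2 by rewrite /c; lra.
have cY : c * Y <= 1 / 2 * Y by rewrite ler_wpM2r.
rewrite (_ : _ + 2 * d = 2 * (n * d) + 3 * d + 36 * (B * d * d) + c * Y); last by rewrite /c; ring.
lra.
Qed.

(** The induction step, at a single point s: a and G are the Taylor
    coefficients of u and of H(gamma) there. The sign hypothesis is what the
    maximum principle provides at a maximum of the absolute value of u_(k+1). *)
Lemma gevrey_step {R : realType} (n s A C K d : R) (a G : nat -> R) (k : nat) :
  let w := mul_var s a in
  let D := fun i => 2 * n * w i + G i - a i in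
  1 <= n -> 1 <= A -> 1 <= C -> 0 <= s -> 2 * A * s <= d -> 2 * A <= d * K ->
  0 < d -> 100 * (2 * n + C + A) * d <= 1 ->
  (forall i, (i <= k)%N -> `|a i| <= A * gevrey_weight K i) ->
  (forall i, (i <= k)%N -> `|G i| <= C * gevrey_weight K i) ->
  `|G k.+1| <= d * gevrey_weight K k.+1 ->
  4 * mul_var s (fun i => i.+1%:R * w i.+1) k.+1
    = D k.+1 + 4 * cauchy_prod (cauchy_prod w w) D k.+1 ->
  0 <= s * (a k.+1 * a k.+2) ->
  `|a k.+1| <= A * gevrey_weight K k.+1.
Proof.
move=> w D n1 A1 C1 s0 As AK d0 dsmall ha hG hGk eqk sgn.
have K0 : 0 < K by rewrite -(pmulr_rgt0 _ d0); lra.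
have W i := gevrey_weight_gt0 i K0.
set g := gevrey_weight K in ha hG hGk W *.
have W0 i : 0 <= g i by exact/ltW/W.
pose Y := `|a k.+1| / g k.+1.
have Y0 : 0 <= Y by rewrite divr_ge0// ltW.
have aY : `|a k.+1| = Y * g k.+1 by rewrite divfK// gt_eqF.
have gS i : 2 * A * g i <= d * g i.+1.
  have -> : d * g i.+1 = d * K * i.+1%:R * g i by rewrite /g gevrey_weightS; ring.
  rewrite ler_wpM2r// (le_trans AK)// ler_peMr ?ler1n//.
  by rewrite mulr_ge0// ltW.
have predle i : (i <= k)%N -> `|a i| <= d / 2 * g i.+1.
  move=> ik; apply: (le_trans (ha i ik)); have := gS i; lra.
have hw i : (i <= k)%N -> `|w i| <= d * g i.
  move=> ik; rewrite /w /mul_var (le_trans (ler_normD _ _))//.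
  have h1 : `|s * a i| <= d / 2 * g i.
    rewrite normrM (ger0_norm s0) (le_trans (ler_wpM2l s0 (ha i ik)))// mulrA.
    by rewrite ler_wpM2r//; lra.
  have h2 : `|if i is j.+1 then a j else 0| <= d / 2 * g i.
    case: i ik {h1} => [|i] ik; last by apply: predle; exact: ltnW.
    by rewrite normr0 mulr_ge0 ?divr_ge0// ltW.
  by rewrite (splitr d) mulrDl lerD.
have hwk : `|w k.+1| <= (d + s * Y) * g k.+1.
  rewrite /w /mul_var (le_trans (ler_normD _ _))// normrM (ger0_norm s0) aY.
  have := predle k (leqnn _); have := mulr_gt0 d0 (W k.+1); lra.
pose B := 2 * n * d + C + A.
have hD i : (i <= k)%N -> `|D i| <= B * g i.
  move=> ik; rewrite /D (le_trans (ler_normB _ _))//.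
  have h : `|2 * n * w i + G i| <= 2 * n * (d * g i) + C * g i.
    rewrite (le_trans (ler_normD _ _))// lerD ?hG// normrM ger0_norm//; last lra.
    by rewrite ler_wpM2l ?hw//; lra.
  by rewrite /B; have := ha i ik; lra.
have hDk : `|D k.+1| <= (B + (2 * n * s + 1) * Y) * g k.+1.
  rewrite /D (le_trans (ler_normB _ _))//.
  have h : `|2 * n * w k.+1 + G k.+1| <= 2 * n * ((d + s * Y) * g k.+1) + d * g k.+1.
    rewrite (le_trans (ler_normD _ _))// lerD// normrM ger0_norm//; last lra.
    by rewrite ler_wpM2l//; lra.
  have nd : d <= n * d by rewrite ler_peMl//; lra.
  have Cd : d <= C * d by rewrite ler_peMl//; lra.
  have Ad : d <= A * d by rewrite ler_peMl//; lra.
  have dC : (d - C) * g k.+1 <= 0.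
    by rewrite mulr_le0_ge0//; lra.
  have Ag : 0 <= A * g k.+1 by rewrite mulr_ge0//; lra.
  by rewrite /B aY; lra.
have hww i : (i <= k)%N -> `|cauchy_prod w w i| <= 3 * d * d * g i.
  move=> ik; apply: cauchy_prod_bound => // l li; apply: hw; exact: leq_trans ik.
have sY0 : 0 <= s * Y by rewrite mulr_ge0.
have cY0 : 0 <= (2 * n * s + 1) * Y.
  by rewrite mulr_ge0// addr_ge0// mulr_ge0//; lra.
have hwwk : `|cauchy_prod w w k.+1| <= (3 * d * d + 2 * d * (s * Y)) * g k.+1.
  have := @cauchy_prod_bound_excess _ K d d (s * Y) (s * Y) w w k.+1 K0 sY0 sY0 isT hw hw hwk hwk.
  by rewrite -/g; lra.
have dsY0 : 0 <= 2 * d * (s * Y) by apply: mulr_ge0 => //; lra.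
have hQ := @cauchy_prod_bound_excess _ K _ _ _ _ (cauchy_prod w w) D k.+1
  K0 dsY0 cY0 isT hww hD hwwk hDk.
rewrite -/g in hQ.
pose rhs := 2 * n * w k.+1 + G k.+1 + 4 * cauchy_prod (cauchy_prod w w) D k.+1 - 4 * (k.+1%:R * a k).
(* The equation, with u_(k+1) and the singular term gathered on one side. *)
have rhsE : rhs = (1 + 4 * (s * (k.+2%:R + k.+1%:R))) * a k.+1
    + 4 * k.+2%:R * s * (s * a k.+2).
  have {}eqk : 4 * (s * (k.+2%:R * (s * a k.+2 + a k.+1)) + k.+1%:R * (s * a k.+1 + a k))
    = 2 * n * w k.+1 + G k.+1 - a k.+1 + 4 * cauchy_prod (cauchy_prod w w) D k.+1 := eqk.
  by rewrite /rhs; move: (cauchy_prod _ _ _) (w k.+1) eqk => Q wk eqk; lra.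
(* Multiply [rhsE] by a k.+1: both terms besides a k.+1 ^+ 2 are nonnegative. *)
have le_rhs : `|a k.+1| <= `|rhs|.
  have [->|ak0] := eqVneq (a k.+1) 0; first by rewrite normr0.
  have ak : 0 < `|a k.+1| by rewrite normr_gt0.
  rewrite -(ler_pM2l ak) -!normrM (le_trans _ (ler_norm _))//.
  rewrite ger0_norm -?expr2 ?sqr_ge0// rhsE.
  have h1 : 0 <= (s * (k.+2%:R + k.+1%:R)) * a k.+1 ^+ 2.
    by rewrite mulr_ge0 ?sqr_ge0// mulr_ge0.
  have h2 : 0 <= 4 * k.+2%:R * (s * (s * (a k.+1 * a k.+2))).
    by apply: mulr_ge0; rewrite // mulr_ge0.
  lra.
have rhs_le : `|rhs| <= (2 * n * (d + s * Y) + d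
       + 4 * (3 * (3 * d * d) * B + 3 * d * d * ((2 * n * s + 1) * Y)
              + (2 * d * (s * Y)) * B) + 2 * d) * g k.+1.
  rewrite /rhs (le_trans (ler_normB _ _))// (le_trans (lerD (ler_normD _ _) (lexx _)))//.
  rewrite (le_trans (lerD (lerD (ler_normD _ _) (lexx _)) (lexx _)))//.
  have h1 : `|2 * n * w k.+1| <= 2 * n * ((d + s * Y) * g k.+1).
    by rewrite normrM ger0_norm ?ler_wpM2l//; lra.
  have h2 : `|4 * cauchy_prod (cauchy_prod w w) D k.+1| = 4 * `|cauchy_prod (cauchy_prod w w) D k.+1|.
    by rewrite normrM ger0_norm.
  have h3 : `|4 * (k.+1%:R * a k)| <= 2 * d * g k.+1.
    rewrite normrM ger0_norm// normrM (ger0_norm (ler0n _ _)).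
    have h4 := ler_wpM2l (ler0n R k.+1) (ha k (leqnn _)).
    have h5 : 2 * A * (k.+1%:R * g k) <= d * K * (k.+1%:R * g k).
      by rewrite ler_wpM2r// mulr_ge0.
    have h6 : d * g k.+1 = d * K * (k.+1%:R * g k) by rewrite /g gevrey_weightS; ring.
    lra.
  lra.
rewrite aY ler_wpM2r//.
apply: (@absorb_excess _ n s A C d Y) => //.
by rewrite -(ler_pM2r (W k.+1)) -aY; exact: le_trans rhs_le.
Qed.

Lemma has_deriv_on_near {R : realType} (b : R) (f : R -> R) (l e : R) :
  0 < b -> 0 < e -> has_deriv_on `[0, b] f 0 l ->
  exists2 s, 0 < s <= b & forall x, 0 <= x <= s -> `|f x - f 0| < e.
Proof.
move=> b0 e0 /has_deriv_on_cvg /cvgrPdist_lt /(_ e e0).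
rewrite near_withinE => /nbhs_ballP[r /= r0 rP].
have m0 : 0 < Num.min b (r / 2) by rewrite lt_min b0 divr_gt0.
have m1 : Num.min b (r / 2) <= b by rewrite ge_min lexx.
have m2 : Num.min b (r / 2) <= r / 2 by rewrite ge_min lexx orbT.
move: (Num.min _ _) m0 m1 m2 => m m0 m1 m2.
exists m; first by rewrite m0.
move=> x /andP[x0 xm]; have [->|xn0] := eqVneq x 0; first by rewrite subrr normr0.
rewrite distrC; apply: rP.
  by rewrite /ball /= sub0r normrN ger0_norm//; lra.
split; last exact/eqP.
by rewrite /= in_itv /= x0 (le_trans xm).
Qed.

(** The constants are chosen in this order: A from u(0), then d so small that
    [absorb_excess] applies, then K large and s1 small in terms of d. *)
Lemma gevrey_solution {R : realType} (n b : R) (H g : R -> R) (u : nat -> R -> R) :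
  1 <= n -> 0 < b -> real_analytic_at H 0 -> g 0 = 0 ->
  (forall x, `[0, b]%classic x -> has_deriv_on `[0, b] g x (u 0%N x)) ->
  taylor_jet `[0, b] u ->
  (forall s, `[0, b]%classic s -> (1 - 2 * n * s) * u 0%N s - H (g s)
    + 4 * ((s * u 0%N s + s ^+ 2 * u 1%N s) / (1 + 4 * s ^+ 2 * u 0%N s ^+ 2)) = 0) ->
  exists s1 A K : R, [/\ 0 < s1 <= b, 1 <= A, 0 < K &
    forall k s, 0 <= s <= s1 -> `|u k s| <= A * gevrey_weight K k].
Proof.
move=> n1 b0 /analytic_taylor[F [C [r [rho [C1 r0 rho0 FH]]]]] g0 gd uj ode.
have I0 : `[0, b]%classic (0 : R) by rewrite /= in_itv /= lexx ltW.
pose A := `|u 0%N 0| + 1.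
have A1 : 1 <= A by rewrite lerDr.
have [s2 /andP[s20 s2b] us2] := has_deriv_on_near b0 ltr01 (uj 0%N 0 I0).
have [s3 /andP[s30 s3b] gs3] := has_deriv_on_near b0 r0 (gd 0 I0).
pose d := (100 * (2 * n + C + A))^-1.
have dB0 : 0 < 100 * (2 * n + C + A) by lra.
have d0 : 0 < d by rewrite invr_gt0.
have dsmall : 100 * (2 * n + C + A) * d <= 1 by rewrite divff// gt_eqF.
pose K := 2 * A / d + 3 * A * rho + C * (3 * A * rho) / d.
have Ar0 : 0 < 3 * A * rho by rewrite mulr_gt0//; lra.
have CAr0 : 0 < C * (3 * A * rho) by rewrite mulr_gt0//; lra.
have K0 : 0 < K by rewrite !addr_gt0 ?divr_gt0//; lra.
have AK : 2 * A <= d * K.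
  rewrite (mulrC d) -ler_pdivrMr// /K -addrA lerDl addr_ge0 ?divr_ge0//; exact/ltW.
have CK : C * (3 * A * rho) <= d * K.
  rewrite (mulrC d) -ler_pdivrMr// /K lerDr addr_ge0 ?divr_ge0//; lra.
have rK : 3 * A * rho <= K.
  rewrite /K addrAC lerDr addr_ge0 ?divr_ge0//; lra.
pose s1 := Num.min (Num.min s2 s3) (d / (2 * A)).
have s10 : 0 < s1 by rewrite !lt_min s20 s30 divr_gt0//; lra.
have s12 : s1 <= s2 by rewrite /s1 !ge_min lexx.
have s13 : s1 <= s3 by rewrite /s1 !ge_min lexx orbT.
have s1d : 2 * A * s1 <= d.
  by rewrite mulrC -ler_pdivlMr; [rewrite /s1 !ge_min lexx orbT|lra].
clearbody K s1 d.
have sub : `[0, s1] `<=` `[0, b].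
  move=> x /=; rewrite !in_itv /= => /andP[-> xs] /=.
  by rewrite (le_trans xs)// (le_trans s12).
have uj1 : taylor_jet `[0, s1] u.
  by move=> k x Ix; apply: has_deriv_on_subset (uj k x (sub _ Ix)).
have gr x : `[0, s1]%classic x -> `|g x| < r.
  rewrite /= in_itv /= => /andP[x0 xs].
  by have := gs3 x; rewrite g0 subr0 x0 (le_trans xs s13) => /(_ isT).
have Gj := @taylor_jet_comp _ `[0, s1] F g u.
have {}Gj : forall k, taylor_jet `[0, s1] (comp_jet F g u k).
  apply: Gj => //.
  - by move=> k x Ix; have [_ + _] := FH _ (gr x Ix); apply.
  - by move=> x Ix; apply: has_deriv_on_subset (gd x (sub _ Ix)).
pose w k x := mul_var x (u^~ x) k.
pose D k x := 2 * n * w k x + comp_jet F g u 0 k x - u k x.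
have wj : taylor_jet `[0, s1] w by exact: taylor_jet_mul_var.
have Dj : taylor_jet `[0, s1] D.
  by apply: taylor_jetB => //; apply: taylor_jetD => //; exact: taylor_jetZ.
(* The jet of 4 s w' - (D + 4 w^2 D), which vanishes. *)
pose E k x := 4 * mul_var x (fun i => i.+1%:R * w i.+1 x) k
  - (D k x + 4 * cauchy_prod (cauchy_prod (w^~ x) (w^~ x)) (D^~ x) k).
have Ej : taylor_jet `[0, s1] E.
  apply: taylor_jetB.
    apply: taylor_jetZ.
    apply: (taylor_jet_mul_var (f := fun i x => i.+1%:R * w i.+1 x)).
    exact: taylor_jet_derive.
  apply: taylor_jetD => //; apply: taylor_jetZ.
  apply: (taylor_jet_cauchy_prod (f := fun k x => cauchy_prod (w^~ x) (w^~ x) k)) => //.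
  exact: taylor_jet_cauchy_prod.
have E0 : forall k x, `[0, s1]%classic x -> E k x = 0.
  apply: taylor_jet_eq0 => // x Ix.
  have [FHx _ _] := FH _ (gr x Ix).
  have := ode x (sub _ Ix).
  rewrite /E /D /w /cauchy_prod /mul_var !big_ord1 /= !addr0 /comp_jet /= FHx.
  set q := 1 + 4 * x ^+ 2 * u 0%N x ^+ 2.
  have q0 : 0 < q by rewrite ltr_pwDl// -mulrA -exprMn mulr_ge0// sqr_ge0.
  move=> /(congr1 (fun z => z * q)); rewrite mul0r [LHS]mulrDl -[4 * _ * q]mulrA divfK ?gt_eqF//.
  by rewrite /q => <-; ring.
exists s1, A, K; split=> //; first by rewrite s10 (le_trans s12).
elim/ltn_ind => -[|k] IH s /andP[s_ge0 s_le].
  rewrite /gevrey_weight !mulr1 /A -[u 0%N s](subrK (u 0%N 0)).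
  rewrite (le_trans (ler_normD _ _))// addrC lerD2l ltW// us2//.
  by rewrite s_ge0 (le_trans s_le).
(* The point of the maximum principle. *)
have [c cI cmax] : exists2 c, c \in `[0, s1]%R & forall t, t \in `[0, s1]%R ->
    `|u k.+1 t| <= `|u k.+1 c|.
  apply: (@EVT_max R (fun x => `|u k.+1 x|)); first exact: ltW.
  have uc := has_deriv_on_continuous (uj1 k.+1).
  by move=> x; apply: cvg_norm; exact: uc.
have cI' : `[0, s1]%classic c by [].
move: cI; rewrite in_itv /= => /andP[c0 cs].
have sI : s \in `[0, s1]%R by rewrite in_itv /= s_ge0.
apply: (le_trans (cmax s sI)).
have IHc i : (i <= k)%N -> `|u i c| <= A * gevrey_weight K i.
  by move=> ik; apply: IH => //; rewrite c0.
have rho_ge0 := ltW rho0; have C0 : 0 <= C by lra. have A0 : 0 <= A by lra.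
have [cb1 cb2] := @comp_jet_bound _ K A C rho k (u^~ c) (fun k j => comp_jet F g u k j c)
  K0 A0 C0 rho_ge0 rK IHc (fun k => let: And3 _ _ h := FH _ (gr c cI') in h k)
  (fun k j => comp_jetS F g u k j c).
apply: (@gevrey_step _ n c A C K d (u^~ c) (fun i => comp_jet F g u 0 i c) k) => //.
- by rewrite (le_trans _ s1d)// ler_wpM2l//; lra.
- move=> i ik; have := cb1 0%N i (leqW ik).
  by rewrite expr0 mulr1 add0n binn mulr1.
- apply: (le_trans (cb2 k (leqnn _))).
  have -> : d * gevrey_weight K k.+1 = d * K * k.+1%:R * gevrey_weight K k.
    by rewrite gevrey_weightS; ring.
  rewrite ler_wpM2r//; first exact/ltW/gevrey_weight_gt0.
  by rewrite (le_trans CK)// ler_peMr ?ler1n// mulr_ge0// ltW.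
- by have := E0 k.+1 c cI'; rewrite /E => /eqP; rewrite subr_eq0 => /eqP.
- have [->|cn0] := eqVneq c 0; first by rewrite mul0r.
  have c_gt0 : 0 < c by rewrite lt_neqAle eq_sym cn0.
  apply: mulr_ge0 => //.
  have := @has_deriv_on_max_norm _ 0 s1 (u k.+1) c _ _ _ (uj1 k.+1 c cI').
  rewrite c_gt0 cs mulrCA pmulr_rge0//; exact.
Qed.

(** * Rescaling *)

(** Iterated derivatives on [a, b] depend on the values of f there only, hence
    may be computed by exhibiting a chain of derivatives. *)
Lemma derive_n_on_eq {R : realType} (a b : R) (f : R -> R) (g : nat -> R -> R) :
  a < b -> (forall x, `[a, b]%classic x -> f x = g 0%N x) ->
  (forall k x, `[a, b]%classic x -> has_deriv_on `[a, b] (g k) x (g k.+1 x)) ->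
  forall k x, `[a, b]%classic x -> derive_n_on `[a, b] k f x = g k x.
Proof.
move=> ab fg gd; elim=> [|k IH] x Ix; first exact: fg.
have axb : a <= x <= b by move: Ix; rewrite /= in_itv.
apply: has_deriv_on_derive => //.
by apply: has_deriv_on_ext (gd k x Ix) => // y Iy; exact/esym/IH.
Qed.

Lemma derivable_n_on_has_deriv {R : realType} (A : set R) (f : R -> R) :
  smooth_on A f -> forall k x, A x ->
  has_deriv_on A (derive_n_on A k f) x (derive_n_on A k.+1 f x).
Proof. by move=> fs k x Ax; exact: fs. Qed.

Lemma L2norm_itv_le {R : realType} (s B : R) (f : R -> R) :
  0 <= s <= 1 -> 0 <= B -> {within `[0, s], continuous f} ->
  (forall x, 0 <= x <= s -> `|f x| <= B) -> (L2norm `[0%R, s] f <= B%:E)%E.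
Proof.
move=> /andP[s0 s1] B0 fc fB.
have mf : measurable_fun setT (f \_ `[0, s]).
  apply/(measurable_restrictT _ _).1; first exact: measurable_itv.
  by apply: subspace_continuous_measurable_fun; first exact: measurable_itv.
rewrite /L2norm unlock.
have -> : B%:E = ((B ^+ 2)%:E `^ 2^-1)%E.
  by rewrite poweR_EFin -powR_mulrn// -powRrM divff ?pnatr_eq0// powRr1.
apply: gt0_ler_poweR; rewrite ?invr_ge0//.
- by rewrite in_itv /= leey integral_ge0// => x _; exact: poweR_ge0.
- by rewrite in_itv /= leey lee_fin sqr_ge0.
apply: (@le_trans _ _ (\int[lebesgue_measure]_(x in `[0%R, s]%classic) (cst (B ^+ 2)%:E x))%E).
  rewrite [leRHS]integral_mkcond; apply: ge0_le_integral => //.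
  - by move=> x _; exact: poweR_ge0.
  - apply: (measurableT_comp (measurable_poweR 2)).
    by apply: measurableT_comp => //; exact/measurable_EFinP.
  - by apply/(measurable_restrictT _ _).1; first exact: measurable_itv.
  - move=> x _; rewrite /patch /=; case: ifPn => xs.
      rewrite lee_fin powR_mulrn// lerXn2r ?nnegrE// fB//.
      by move: xs; rewrite inE /= in_itv.
    by rewrite normr0 powR0 ?pnatr_eq0.
have len : (lebesgue_measure `[0%R, s]%classic <= 1%:E :> \bar R)%E.
  rewrite lebesgue_measure_itv /= lte_fin; case: ifPn => _; last exact: lee01.
  by rewrite oppr0 adde0 lee_fin.
rewrite integral_cst// -[leRHS]mule1; apply: lee_wpmul2l => //.
by rewrite lee_fin sqr_ge0.
Qed.

(** With q = lam K <= 1/8 the factors (m+1)^3 q^(m+1) and (m+1)^2 q^m are at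
    most 1, as m + 1 <= 2^(m+1) and m + 1 <= 2^m; the remaining factor A lam
    is at most 1/3. *)
Lemma gevrey_rescaled_bound {R : realType} (A K lam : R) (m : nat) :
  0 < A -> 0 < K -> 0 < lam -> 8 * K * lam <= 1 -> 3 * A * lam <= 1 ->
  2 * (lam ^+ m.+2 * (A * gevrey_weight K m.+1 * (m.+1)`!%:R))
    + m.+1%:R * (lam ^+ m.+1 * (A * gevrey_weight K m * m`!%:R))
  <= m`!%:R ^+ 2 / m.+1%:R.
Proof.
move=> A0 K0 l0 Kl Al; pose q := lam * K.
have q0 : 0 <= q by rewrite mulr_ge0 ?ltW.
have q8 : q <= 8^-1 by rewrite -(ler_pM2l (x := 8))// divff// /q; lra.
have qX k : q ^+ k * (8 ^ k)%:R <= 1.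
  rewrite natrX -exprMn exprn_ile1//; first by rewrite mulr_ge0.
  by move: q8; lra.
have cube k : (8 ^ k = (2 ^ k) ^ 3)%N by rewrite -expnM mulnC expnM.
have h1 : m.+1%:R ^+ 3 * q ^+ m.+1 <= 1 :> R.
  rewrite mulrC (le_trans _ (qX m.+1))// ler_wpM2l ?exprn_ge0// -natrX ler_nat.
  by rewrite cube leq_exp2r// ltnW// ltn_expl.
have h2 : m.+1%:R ^+ 2 * q ^+ m <= 1 :> R.
  rewrite mulrC (le_trans _ (qX m))// ler_wpM2l ?exprn_ge0// -natrX ler_nat cube.
  have le2 : (m.+1 ^ 2 <= (2 ^ m) ^ 2)%N by rewrite leq_exp2r// ltn_expl.
  by apply: leq_trans le2 _; rewrite leq_pexp2l// expn_gt0.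
rewrite ler_pdivlMr// /gevrey_weight factS natrM.
set N := m.+1%:R in h1 h2 *.
rewrite (_ : _ * N = m`!%:R ^+ 2 * (2 * (A * lam) * (N ^+ 3 * q ^+ m.+1)
   + (A * lam) * (N ^+ 2 * q ^+ m))); last first.
  by rewrite /q !exprMn !exprS; ring.
rewrite ler_piMr ?sqr_ge0//.
have Al0 : 0 <= A * lam by rewrite mulr_ge0 ?ltW.
have := ler_wpM2l Al0 h1; have := ler_wpM2l Al0 h2; lra.
Qed.

Theorem theorem5p1 (R : realType) (n : nat) (n_ge2 : (2 <= n)%N)
    (Gam Om : set 'rV[R]_n.+1) (H : R -> R) (d0 : R)
    (Gam_iso : isoparametric_hypersurface Gam)
    (Om_side : is_side Gam Om)
    (H_mean : mean_curvature_of_parallels Gam Om d0 H)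
    (d0_gt0 : 0 < d0)
    (H_gt0 : forall d : R, 0 <= d < d0 -> 0 < H d)
    (dH_lt0 : forall d : R, 0 <= d < d0 -> derive1 H d < 0)
    (H_d0 : H d0 = 0)
    (H_analytic : forall d : R, 0 <= d <= d0 -> real_analytic_at H d) :
  exists2 M : R, 1 <= M &
    forall (sstar : R) (gam : R -> R),
      0 < sstar -> singular_ivp_solution n H d0 sstar gam ->
      exists lam s0 : R,
        [/\ 0 < lam <= 1, 0 < s0, lam * s0 <= sstar &
            let gamt := fun s => gam (lam * s) in
            let I0 := `[0, s0]%classic in
            forall (j : nat) (s : R), (2 <= j)%N -> 0 <= s <= s0 ->
              (L2norm `[0%R, s]%classic (derive_n_on I0 j gamt)
               + `|derive_n_on I0 (j - 1)
                     (fun t => t * derive_n_on I0 1 gamt t) s|%:E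
               <= (M ^ (j%:Z - 3) * (((j - 2)`!)%:R ^+ 2 / (j - 1)%:R))%R%:E)%E].
Proof.
exists 1 => // b gam b0 [gs gI g0 ode].
pose D k := derive_n_on `[0, b] k gam.
have Dd : forall k x, `[0, b]%classic x -> has_deriv_on `[0, b] (D k) x (D k.+1 x).
  exact: derivable_n_on_has_deriv.
pose u k x := (k`!%:R)^-1 * D k.+1 x.
have uj : taylor_jet `[0, b] u.
  move=> k x Ix; rewrite /u factS natrM invfM !mulrA divff ?pnatr_eq0// mul1r.
  by apply: has_deriv_onZ; exact: Dd.
have n1 : 1 <= n%:R :> R by rewrite ler1n ltnW.
have H0 : real_analytic_at H 0 by apply: H_analytic; rewrite lexx ltW.
have [||s1 [A [K [/andP[s10 s1b] A1 K0 uB]]]] :=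
    @gevrey_solution _ n%:R b H gam u n1 b0 H0 g0 _ uj.
- by move=> x Ix; rewrite /u invr1 mul1r; exact: Dd.
- by move=> s Is; rewrite /u !invr1 !mul1r; exact: ode.
have A0 : 0 < A by lra.
pose lam := Num.min (Num.min s1 1) (Num.min (8 * K)^-1 (3 * A)^-1).
have lam0 : 0 < lam by rewrite !lt_min s10 ltr01 !invr_gt0 !mulr_gt0.
have lam1 : lam <= 1 by rewrite /lam !ge_min lexx orbT.
have lams : lam <= s1 by rewrite /lam !ge_min lexx.
have lamK : 8 * K * lam <= 1.
  by rewrite mulrC -ler_pdivlMr ?mulr_gt0// div1r /lam !ge_min lexx !orbT.
have lamA : 3 * A * lam <= 1.
  by rewrite mulrC -ler_pdivlMr ?mulr_gt0// div1r /lam !ge_min lexx !orbT.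
clearbody lam.
exists lam, 1; split => //; [by rewrite lam0|by rewrite mulr1 (le_trans lams)|].
move=> gamt I0 j s j2 /andP[s_ge0 s_le1].
have scale x : I0 x -> `[0, s1]%classic (lam * x).
  rewrite /I0 /= !in_itv /= => /andP[x0 x1].
  by rewrite mulr_ge0 ?(ltW lam0)//= (le_trans _ lams)// ler_piMr// ltW.
have sub x : `[0, s1]%classic x -> `[0, b]%classic x.
  by rewrite /= !in_itv /= => /andP[-> xs]; rewrite (le_trans xs).
pose G k x := lam ^+ k * D k (lam * x).
have Gd k x : I0 x -> has_deriv_on I0 (G k) x (G k.+1 x).
  move=> Ix; rewrite /G exprSr -mulrA; apply: has_deriv_onZ.
  apply: (@has_deriv_on_scale _ `[0, b]); first by rewrite gt_eqF.
    by move=> y Iy; exact/sub/scale.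
  by apply: Dd; exact/sub/scale.
have GE k x : I0 x -> derive_n_on I0 k gamt x = G k x.
  apply: (derive_n_on_eq ltr01) => // y _.
  by rewrite /G mul1r.
pose P k x := x * G k.+1 x + k%:R * G k x.
have PE k x : I0 x -> derive_n_on I0 k (fun t => t * derive_n_on I0 1 gamt t) x = P k x.
  apply: (derive_n_on_eq ltr01) => [y Iy|i y Iy].
    by rewrite GE// /P mul0r addr0.
  have -> : P i.+1 y = 1 * G i.+1 y + id y * G i.+2 y + i%:R * G i.+1 y.
    by rewrite /P -natr1; ring.
  apply: has_deriv_onD; last by apply: has_deriv_onZ; exact: Gd.
  by apply: has_deriv_onM; [exact: has_deriv_on_id|exact: Gd].
have GB k x : I0 x -> `|G k.+1 x| <= lam ^+ k.+1 * (A * gevrey_weight K k * k`!%:R).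
  move=> Ix; have := uB k (lam * x).
  have -> : 0 <= lam * x <= s1 by move: (scale x Ix); rewrite /= in_itv.
  move=> /(_ isT) h.
  have -> : G k.+1 x = lam ^+ k.+1 * (u k (lam * x) * k`!%:R).
    rewrite /u mulrAC mulVf ?mul1r// pnatr_eq0 -lt0n; exact: fact_gt0.
  rewrite normrM ger0_norm ?exprn_ge0 ?(ltW lam0)// ler_wpM2l ?exprn_ge0 ?(ltW lam0)//.
  by rewrite normrM normr_nat ler_wpM2r.
have sI : I0 s by rewrite /I0 /= in_itv /= s_ge0.
case: j j2 => [|[|m]]// _; rewrite !subSS !subn0 exp1rz mul1r.
have in01 x : 0 <= x <= s -> I0 x.
  by move=> /andP[x0 xs]; rewrite /I0 /= in_itv /= x0 (le_trans xs).
set B := lam ^+ m.+2 * (A * gevrey_weight K m.+1 * (m.+1)`!%:R).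
have L2 : (L2norm `[0%R, s] (derive_n_on I0 m.+2 gamt) <= B%:E)%E.
  apply: L2norm_itv_le.
  - by rewrite s_ge0.
  - by apply: le_trans (GB m.+1 s sI).
  - apply: (@has_deriv_on_continuous _ _ _ (G m.+3)) => x xs.
    have Ix : I0 x by apply: in01; move: xs; rewrite /= in_itv.
    apply: (has_deriv_on_ext (f := G m.+2)) => //.
      by move=> y ys; rewrite GE//; apply: in01; move: ys; rewrite /= in_itv.
    apply: has_deriv_on_subset (Gd m.+2 x Ix) => y ys.
    by apply: in01; move: ys; rewrite /= in_itv.
  - by move=> x xs; rewrite GE; [apply: GB|]; exact: in01.
apply: (le_trans (leeD L2 (lexx _))); rewrite PE// -EFinD lee_fin.
apply: le_trans (gevrey_rescaled_bound m A0 K0 lam0 lamK lamA).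
rewrite -/B (mulr_natl B 2) mulr2n -addrA lerD2l /P (le_trans (ler_normD _ _))//.
rewrite (normrM s) (normrM m.+1%:R) normr_nat.
rewrite lerD//; last by rewrite ler_wpM2l// GB.
by rewrite (ger0_norm s_ge0) (le_trans _ (GB m.+1 s sI))// ler_piMl.
Qed.
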